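(* Assume that the arrival rate vector $\lambda$ is inside the capacity region, i.e. $\lambda\in[0,1]^{\mathbb{J}}$, $\sum_{i\in[n]}\lambda(i,j)<1$ for all $j\in[n]$ and $\sum_{j\in[n]}\lambda(i,j)<1$ for all $i\in[n]$. Let $(q^*_t,\mu^*_t)_{t\ge0}$ be the queue-length process and scheduling policy produced by the Optimal Control Algorithm (described in the context) from an initial state $q_0\in\mathbb{R}_+^{\mathbb{J}}$. Then the system empties in finite time, i.e. there is $T<\infty$ with $q^*_T=0$. Moreover, if $q^*_T=0$ for some $T\ge 0$, then $q^*_t=0$ for all $t\ge T$.
   Context: **Switch notation.** Fix an integer $n\ge 1$; $[n]=\{1,\dots,n\}$ and $\mathbb{J}=[n]\times[n]$ is the set of queues. The set of basic schedules is $\mathbb{I}=\{s\in\{0,1\}^{\mathbb{J}}:\sum_{i}s(i,j)\le 1\ \forall j,\ \sum_{j}s(i,j)\le 1\ \forall i\}$ (the zero schedule is included). Write $\rho\in s$ if $s(\rho)=1$. The matrix $A\in\{0,1\}^{\mathbb{I}\times\mathbb{J}}$ is $A(s,\rho)=s(\rho)$, and $(\mu A)(\rho)=\sum_{s}\mu(s)A(s,\rho)$ for $\mu\in\mathbb{R}^{\mathbb{I}}$. $\|\cdot\|_1$ is the 1-norm and $\cdot$ the inner product. $c\in(0,\infty)^{\mathbb{J}}$ is the vector of cost coefficients, $w(s)=\sum_{\rho\in s}c(\rho)$ is the weight of $s\in\mathbb{I}$, and $\lambda\in[0,1]^{\mathbb{J}}$ is the arrival rate vector. **Linear programs.** For a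 state $q\in\mathbb{R}_+^{\mathbb{J}}$ and $\tau\in\mathbb{R}_+$ let $\mathbb{I}_\tau=\{s\in\mathbb{I}:w(s)\ge\tau\}$, $\mathbb{J}_q=\{\rho\in\mathbb{J}:q(\rho)=0\}$, $w_\tau=[w(s)-\tau:s\in\mathbb{I}_\tau]$, $A_{\tau,q}=[A(s,\rho):s\in\mathbb{I}_\tau,\rho\in\mathbb{J}_q]$, $\lambda_q=[\lambda(\rho):\rho\in\mathbb{J}_q]$. For $\tau$ with $\mathbb{I}_\tau\ne\emptyset$, $(P_{q,\tau})$ is the linear program: maximize $w_\tau\cdot\nu$ over $\nu\in\mathbb{R}^{\mathbb{I}_\tau}$ subject to $\nu A_{\tau,q}\le\lambda_q$, $\nu\ge 0$. A number $\tau\in\mathbb{R}_+$ is a critical threshold of $q$ if $(P_{q,\tau})$ has an optimal solution $\nu$ with $\|\nu\|_1=1$. For a real $\gamma$ let $\mathbb{Q}(q,\tau,\gamma)=\{\nu\in\mathbb{R}^{\mathbb{I}_\tau}:\nu\ge 0,\ w_\tau\cdot\nu=\gamma,\ \|\nu\|_1=1,\ \nu A_{\tau,q}\le\lambda_q\}$. **Algorithm 1 (input $q$).** Let $\mathbb{W}=\{w(s):s\in\mathbb{I}\}=\{\tau_1>\tau_2>\cdots\}$. Set $l=1$ and $h=\min\{k:\exists s\in\mathbb{I}\text{ with }w(s)=\tau_k,\ q(\rho)\ne 0\ \forall\rho\in s\}$. Let $\gamma_1$ be the optimal value of $(P_{q,\tau_1})$; if $\mathbb{Q}(q,\tau_1,\gamma_1)\ne\emptyset$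 return $1$. Let $\gamma_h$ be the optimal value of $(P_{q,\tau_h})$; if $\mathbb{Q}(q,\tau_h,\gamma_h)\neq\emptyset$ return $h$. While $l<h-1$: put $m=\lfloor (l+h)/2\rfloor$, obtain the optimal value $\gamma_m$ and an optimal solution $\nu^*$ of $(P_{q,\tau_m})$; if $\mathbb{Q}(q,\tau_m,\gamma_m)\ne\emptyset$ return $m$; otherwise set $h=m$ if $\|\nu^*\|_1>1$, and $l=m$ if not. When the loop ends, return $-l$. **Algorithm 2 (input $q$ and a positive integer $l$).** Let $\bar w=[w(s):s\in\mathbb{I}_{\tau_l}]$ and let $(P'_{q,\tau})$ be: maximize $\bar w\cdot\nu-\tau\|\nu\|_1$ over $\nu\in\mathbb{R}^{\mathbb{I}_{\tau_l}}$ subject to $\nu A_{\tau_l,q}\le\lambda_q$, $\nu\ge 0$. For real $\gamma$ let $\mathbb{Q}'(q,\tau,\gamma)=\{\nu\in\mathbb{R}^{\mathbb{I}_{\tau_l}}:\bar w\cdot\nu-\tau=\gamma,\ \|\nu\|_1=1,\ \nu A_{\tau_l,q}\le\lambda_q,\ \nu\ge 0\}$. Set $\tau^L_0=\tau_l$, $\tau^S_0=\tau_{l+1}$, and let $\nu^L_0,\nu^S_0$ be basic optimal solutions of $(P'_{q,\tau})$ with $\tau=\tau^L_0,\tau^S_0$ respectively. For $k=0,1,2,\dots$: set $\tau^M_k=\bar w\cdot(\nu^S_k-\nu^L_k)/(\|\nu^S_k\|_1-\|\nu^L_k\|_1)$; obtain the optimal value $\gamma^*$ and a basic optimal solution $\nu^M_k$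 of $(P'_{q,\tau})$ with $\tau=\tau^M_k$; if $\mathbb{Q}'(q,\tau^M_k,\gamma^* )\ne\emptyset$ return $\tau^M_k$; otherwise, if $\|\nu^M_k\|_1>1$ set $(\tau^S_{k+1},\nu^S_{k+1})=(\tau^M_k,\nu^M_k)$ and $(\tau^L_{k+1},\nu^L_{k+1})=(\tau^L_k,\nu^L_k)$, and else set $(\tau^L_{k+1},\nu^L_{k+1})=(\tau^M_k,\nu^M_k)$ and $(\tau^S_{k+1},\nu^S_{k+1})=(\tau^S_k,\nu^S_k)$. **Algorithm 3 (input $q$).** Let $m$ be the output of Algorithm 1 on $q$. If $m>0$ return $\tau_m$; otherwise return the output of Algorithm 2 with input $q$ and $l=-m$. **Optimal Control Algorithm (Algorithm 4) with initial state $q_0$.** Set $k=0$, $t_0=0$, $q^*_0=q_0$. While $t_k<\infty$: let $\hat\tau_k$ be the output of Algorithm 3 with input $q^*_{t_k}$; let $\gamma_k$ be the optimal value of $(P_{q,\tau})$ with $q=q^*_{t_k}$, $\tau=\hat\tau_k$; choose a point $\nu_k\in\mathbb{Q}(q^*_{t_k},\hat\tau_k,\gamma_k)$; define $\mu_k\in\mathbb{R}^{\mathbb{I}}$ by $\mu_k(s)=\nu_k(s)$ for $s\in\mathbb{I}_{\hat\tau_k}$ and $\mu_k(s)=0$ otherwise; set $$t_{k+1}=t_k+\min\Big\{\tfrac{q^*_{t_k}(\rho)}{(\mu_kA)(\rho)-\lambda(\rho)}:\rho\in\mathbb{J}\setminus\mathbb{J}_{q^*_{t_k}},\ (\mu_kA)(\rho)-\lambda(\rho)>0\Big\}$$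 (minimum over the empty set is $+\infty$); set $\mu^*_t=\mu_k$ for $t\in[t_k,t_{k+1})$ and $q^*_t=q^*_{t_k}+(t-t_k)\lambda-(t-t_k)\mu_kA$ for $t\in[t_k,t_{k+1}]$; increase $k$ by one.
   Formalization: The formal theorem assumes that the switching times t_k do not accumulate, so that the process is defined for every t ≥ 0; some admissible choices of ν_k make t_k converge to a finite limit before the system has emptied, and for such runs the claim fails. *)

(* Defs.v *)
From HB Require Import structures.
From mathcomp Require Import all_boot all_order all_algebra.
From mathcomp Require Import reals constructive_ereal.

Set Implicit Arguments.
Unset Strict Implicit.
Unset Printing Implicit Defensive.

Import Order.TTheory GRing.Theory Num.Theory.
Local Open Scope ring_scope.

Definition dot (R : realType) (S : finType) (a x : {ffun S -> R}) : R :=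
  \sum_s a s * x s.

Definition norm1 (R : realType) (S : finType) (x : {ffun S -> R}) : R :=
  \sum_s `|x s|.

(** Optimization over [{x | x M <= b, x >= 0}].  Variables are indexed by [S] and inequality constraints by [P].  The
    objective is an arbitrary function, so that [w . x - tau * norm1 x] can be
    written as such although it is linear only where [x >= 0]. *)

Definition feasible (R : realType) (S P : finType) (M : S -> P -> R)
    (b : P -> R) (x : {ffun S -> R}) : Prop :=
  (forall p, \sum_s x s * M s p <= b p) /\ (forall s, 0 <= x s).

Definition optimal (R : realType) (S P : finType) (M : S -> P -> R)
    (b : P -> R) (f : {ffun S -> R} -> R) (x : {ffun S -> R}) : Prop :=
  feasible M b x /\ (forall y, feasible M b y -> f y <= f x).

Definition optimal_value (R : realType) (S P : finType) (M : S -> P -> R)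
    (b : P -> R) (f : {ffun S -> R} -> R) (gamma : R) : Prop :=
  exists2 x, optimal M b f x & f x = gamma.

(** The constraints are indexed by [S + P]: [inl s] is [x s >= 0] and [inr p]
    is [(x M) p <= b p]. *)
Definition active (R : realType) (S P : finType) (M : S -> P -> R)
    (b : P -> R) (x : {ffun S -> R}) (k : S + P) : Prop :=
  match k with
  | inl s => x s = 0
  | inr p => \sum_s x s * M s p = b p
  end.

Definition gradient (R : realType) (S P : finType) (M : S -> P -> R)
    (k : S + P) : {ffun S -> R^o} :=
  match k with
  | inl s => [ffun s' => (s' == s)%:R]
  | inr p => [ffun s' => M s' p]
  end.

(** A basic solution is one at which as many linearly independent constraints
    are active as there are variables. *)
Definition basic (R : realType) (S P : finType) (M : S -> P -> R)
    (b : P -> R) (x : {ffun S -> R}) : Prop :=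
  exists B : {set S + P},
    [/\ #|B| = #|S|,
        (forall k, k \in B -> active M b x k)
      & free [seq gradient M k | k <- enum B]].

Definition basic_optimal (R : realType) (S P : finType) (M : S -> P -> R)
    (b : P -> R) (f : {ffun S -> R} -> R) (x : {ffun S -> R}) : Prop :=
  optimal M b f x /\ basic M b x.

Definition queue (n : nat) : finType := ('I_n * 'I_n)%type.

Definition is_schedule (n : nat) (s : {ffun queue n -> bool}) : bool :=
  [forall j : 'I_n, (\sum_(i < n) s (i, j) <= 1)%N] &&
  [forall i : 'I_n, (\sum_(j < n) s (i, j) <= 1)%N].

Definition schedule (n : nat) : finType :=
  {s : {ffun queue n -> bool} | is_schedule s}.

Definition serves (n : nat) (s : schedule n) (r : queue n) : bool := sval s r.

Definition Amat (R : realType) (n : nat) (s : schedule n) (r : queue n) : R :=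
  (serves s r)%:R.

Definition muA (R : realType) (n : nat) (mu : {ffun schedule n -> R})
    (r : queue n) : R :=
  \sum_s mu s * Amat R s r.

Definition weight (R : realType) (n : nat) (c : {ffun queue n -> R})
    (s : schedule n) : R :=
  \sum_(r | serves s r) c r.

Definition in_capacity_region (R : realType) (n : nat)
    (lambda : {ffun queue n -> R}) : Prop :=
  [/\ forall r, 0 <= lambda r <= 1,
      forall j : 'I_n, \sum_(i < n) lambda (i, j) < 1
    & forall i : 'I_n, \sum_(j < n) lambda (i, j) < 1].

Definition Itau (R : realType) (n : nat) (c : {ffun queue n -> R}) (tau : R) :
    finType :=
  {s : schedule n | tau <= weight c s}.

Definition Jq (R : realType) (n : nat) (q : {ffun queue n -> R}) : finType :=
  {r : queue n | q r == 0}.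

Definition Atq (R : realType) (n : nat) (c : {ffun queue n -> R}) (tau : R)
    (q : {ffun queue n -> R}) (s : Itau c tau) (r : Jq q) : R :=
  Amat R (sval s) (sval r).
Arguments Atq {R n} c tau q s r.

Definition lambdaq (R : realType) (n : nat) (lambda q : {ffun queue n -> R})
    (r : Jq q) : R :=
  lambda (sval r).
Arguments lambdaq {R n} lambda q r.

Definition wtau (R : realType) (n : nat) (c : {ffun queue n -> R}) (tau : R) :
    {ffun Itau c tau -> R} :=
  [ffun s => weight c (sval s) - tau].

Definition P_optimal (R : realType) (n : nat) (c lambda q : {ffun queue n -> R})
    (tau : R) (nu : {ffun Itau c tau -> R}) : Prop :=
  optimal (Atq c tau q) (lambdaq lambda q) (dot (wtau c tau)) nu.
Arguments P_optimal {R n} c lambda q tau nu.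

Definition P_value (R : realType) (n : nat) (c lambda q : {ffun queue n -> R})
    (tau gamma : R) : Prop :=
  optimal_value (Atq c tau q) (lambdaq lambda q) (dot (wtau c tau)) gamma.

Definition Qset (R : realType) (n : nat) (c lambda q : {ffun queue n -> R})
    (tau gamma : R) (nu : {ffun Itau c tau -> R}) : Prop :=
  [/\ feasible (Atq c tau q) (lambdaq lambda q) nu,
      dot (wtau c tau) nu = gamma
    & norm1 nu = 1].
Arguments Qset {R n} c lambda q tau gamma nu.

Definition Qset_nonempty (R : realType) (n : nat)
    (c lambda q : {ffun queue n -> R}) (tau gamma : R) : Prop :=
  exists nu, Qset c lambda q tau gamma nu.

(** The algorithms pick arbitrary optimal solutions, so each is given as the
    relation between its input and its possible outputs. *)

(** Indexed from 0 here, from 1 in [tau_]. *)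
Definition weights (R : realType) (n : nat) (c : {ffun queue n -> R}) : seq R :=
  sort >=%R (undup [seq weight c s | s <- enum (schedule n)]).

Definition tau_ (R : realType) (n : nat) (c : {ffun queue n -> R}) (k : nat) :
    R :=
  nth 0 (weights c) k.-1.

(** The zero schedule satisfies the predicate, so [find] succeeds. *)
Definition alg1_h (R : realType) (n : nat) (c q : {ffun queue n -> R}) : nat :=
  (find (fun tau => [exists s : schedule n,
           (weight c s == tau) && [forall r, serves s r ==> (q r != 0)]])
        (weights c)).+1.

Inductive alg1_loop (R : realType) (n : nat) (c lambda q : {ffun queue n -> R}) :
    nat -> nat -> int -> Prop :=
| Alg1_exit l h :
    ~~ (l < h - 1)%N ->
    alg1_loop c lambda q l h (- l%:Z)
| Alg1_found l h gamma :
    let m := ((l + h)./2)%N in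
    (l < h - 1)%N ->
    P_value c lambda q (tau_ c m) gamma ->
    Qset_nonempty c lambda q (tau_ c m) gamma ->
    alg1_loop c lambda q l h m%:Z
| Alg1_set_h l h gamma nu out :
    let m := ((l + h)./2)%N in
    (l < h - 1)%N ->
    P_value c lambda q (tau_ c m) gamma ->
    P_optimal c lambda q (tau_ c m) nu ->
    ~ Qset_nonempty c lambda q (tau_ c m) gamma ->
    1 < norm1 nu ->
    alg1_loop c lambda q l m out ->
    alg1_loop c lambda q l h out
| Alg1_set_l l h gamma nu out :
    let m := ((l + h)./2)%N in
    (l < h - 1)%N ->
    P_value c lambda q (tau_ c m) gamma ->
    P_optimal c lambda q (tau_ c m) nu ->
    ~ Qset_nonempty c lambda q (tau_ c m) gamma ->
    ~~ (1 < norm1 nu) ->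
    alg1_loop c lambda q m h out ->
    alg1_loop c lambda q l h out.

Inductive alg1 (R : realType) (n : nat) (c lambda q : {ffun queue n -> R}) :
    int -> Prop :=
| Alg1_first gamma1 :
    P_value c lambda q (tau_ c 1) gamma1 ->
    Qset_nonempty c lambda q (tau_ c 1) gamma1 ->
    alg1 c lambda q 1
| Alg1_last gamma1 gammah :
    let h := alg1_h c q in
    P_value c lambda q (tau_ c 1) gamma1 ->
    ~ Qset_nonempty c lambda q (tau_ c 1) gamma1 ->
    P_value c lambda q (tau_ c h) gammah ->
    Qset_nonempty c lambda q (tau_ c h) gammah ->
    alg1 c lambda q h%:Z
| Alg1_search gamma1 gammah out :
    let h := alg1_h c q in
    P_value c lambda q (tau_ c 1) gamma1 ->
    ~ Qset_nonempty c lambda q (tau_ c 1) gamma1 ->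
    P_value c lambda q (tau_ c h) gammah ->
    ~ Qset_nonempty c lambda q (tau_ c h) gammah ->
    alg1_loop c lambda q 1 h out ->
    alg1 c lambda q out.

Definition wbar (R : realType) (n : nat) (c : {ffun queue n -> R}) (l : nat) :
    {ffun Itau c (tau_ c l) -> R} :=
  [ffun s => weight c (sval s)].

Definition P'_objective (R : realType) (n : nat) (c : {ffun queue n -> R})
    (l : nat) (tau : R) (nu : {ffun Itau c (tau_ c l) -> R}) : R :=
  dot (wbar c l) nu - tau * norm1 nu.
Arguments P'_objective {R n} c l tau nu.

Definition P'_value (R : realType) (n : nat) (c lambda q : {ffun queue n -> R})
    (l : nat) (tau gamma : R) : Prop :=
  optimal_value (Atq c (tau_ c l) q) (lambdaq lambda q)
    (P'_objective c l tau) gamma.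

Definition P'_basic_optimal (R : realType) (n : nat)
    (c lambda q : {ffun queue n -> R}) (l : nat) (tau : R)
    (nu : {ffun Itau c (tau_ c l) -> R}) : Prop :=
  basic_optimal (Atq c (tau_ c l) q) (lambdaq lambda q)
    (P'_objective c l tau) nu.
Arguments P'_basic_optimal {R n} c lambda q l tau nu.

Definition Q'set_nonempty (R : realType) (n : nat)
    (c lambda q : {ffun queue n -> R}) (l : nat) (tau gamma : R) : Prop :=
  exists nu : {ffun Itau c (tau_ c l) -> R},
    [/\ feasible (Atq c (tau_ c l) q) (lambdaq lambda q) nu,
        dot (wbar c l) nu - tau = gamma
      & norm1 nu = 1].

Definition alg2_tauM (R : realType) (n : nat) (c : {ffun queue n -> R})
    (l : nat) (nuL nuS : {ffun Itau c (tau_ c l) -> R}) : R :=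
  dot (wbar c l) (nuS - nuL) / (norm1 nuS - norm1 nuL).

(** [alg2_loop lambda q tauL nuL tauS nuS out]: from the current values of
    [tau^L, nu^L, tau^S, nu^S] the iteration may return [out]. *)
Inductive alg2_loop (R : realType) (n : nat) (c lambda q : {ffun queue n -> R})
    (l : nat) :
    R -> {ffun Itau c (tau_ c l) -> R} -> R -> {ffun Itau c (tau_ c l) -> R} ->
    R -> Prop :=
| Alg2_found tauL tauS gamma (nuL nuS : {ffun Itau c (tau_ c l) -> R}) :
    let tauM := alg2_tauM nuL nuS in
    P'_value c lambda q l tauM gamma ->
    Q'set_nonempty c lambda q l tauM gamma ->
    alg2_loop lambda q tauL nuL tauS nuS tauM
| Alg2_set_S tauL tauS gamma out
    (nuL nuS nuM : {ffun Itau c (tau_ c l) -> R}) :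
    let tauM := alg2_tauM nuL nuS in
    P'_value c lambda q l tauM gamma ->
    P'_basic_optimal c lambda q l tauM nuM ->
    ~ Q'set_nonempty c lambda q l tauM gamma ->
    1 < norm1 nuM ->
    alg2_loop lambda q tauL nuL tauM nuM out ->
    alg2_loop lambda q tauL nuL tauS nuS out
| Alg2_set_L tauL tauS gamma out
    (nuL nuS nuM : {ffun Itau c (tau_ c l) -> R}) :
    let tauM := alg2_tauM nuL nuS in
    P'_value c lambda q l tauM gamma ->
    P'_basic_optimal c lambda q l tauM nuM ->
    ~ Q'set_nonempty c lambda q l tauM gamma ->
    ~~ (1 < norm1 nuM) ->
    alg2_loop lambda q tauM nuM tauS nuS out ->
    alg2_loop lambda q tauL nuL tauS nuS out.

Definition alg2 (R : realType) (n : nat) (c lambda q : {ffun queue n -> R})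
    (l : nat) (out : R) : Prop :=
  exists nuL nuS : {ffun Itau c (tau_ c l) -> R},
    [/\ P'_basic_optimal c lambda q l (tau_ c l) nuL,
        P'_basic_optimal c lambda q l (tau_ c l.+1) nuS
      & alg2_loop lambda q (tau_ c l) nuL (tau_ c l.+1) nuS out].

Definition alg3 (R : realType) (n : nat) (c lambda q : {ffun queue n -> R})
    (out : R) : Prop :=
  exists2 m : int, alg1 c lambda q m &
    if 0 < m then out = tau_ c `|m|%N else alg2 c lambda q `|m|%N out.

Definition extend0 (R : realType) (n : nat) (c : {ffun queue n -> R}) (tau : R)
    (nu : {ffun Itau c tau -> R}) : {ffun schedule n -> R} :=
  [ffun s => oapp nu 0 (insub s)].

(** The time until the first draining queue empties, [+oo] if none drains. *)
Definition holding_time (R : realType) (n : nat) (lambda q : {ffun queue n -> R})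
    (mu : {ffun schedule n -> R}) : \bar R :=
  \big[Order.min/+oo%E]_(r | (q r != 0) && (0 < muA mu r - lambda r))
    (q r / (muA mu r - lambda r))%:E.

(** One pass through the loop body at time [tk], with [tk'] the next switching
    time. *)
Definition oca_step (R : realType) (n : nat) (c lambda : {ffun queue n -> R})
    (q : R -> {ffun queue n -> R}) (mu : R -> {ffun schedule n -> R})
    (tk : R) (tk' : \bar R) : Prop :=
  exists (tau gamma : R) (nu : {ffun Itau c tau -> R}),
    let muk := extend0 nu in
    [/\ alg3 c lambda (q tk) tau /\ P_value c lambda (q tk) tau gamma,
        Qset c lambda (q tk) tau gamma nu,
        tk' = (tk%:E + holding_time lambda (q tk) muk)%E,
        forall t : R, (tk%:E <= t%:E < tk')%E -> mu t = muk
      & forall t : R, (tk%:E <= t%:E <= tk')%E ->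
          forall r, q t r =
            q tk r + (t - tk) * lambda r - (t - tk) * muA muk r].

(** [(q t, mu t)] for [t >= 0] is produced by the algorithm from [q0], for some
    resolution of its choices; [t_ k] are the switching times.  The last
    condition says that the algorithm does determine a process on all of
    [[0, +oo[]; it is automatic when some [t_ k] is [+oo], and otherwise says
    that the switching times do not accumulate (which a choice of the points
    of [Qset] can cause). The values at negative times are irrelevant. *)
Definition oca_process (R : realType) (n : nat) (c lambda q0 : {ffun queue n -> R})
    (q : R -> {ffun queue n -> R}) (mu : R -> {ffun schedule n -> R}) : Prop :=
  exists t_ : nat -> \bar R,
    [/\ t_ 0%N = 0%E /\ q 0 = q0,
        forall (k : nat) (tk : R),
          t_ k = tk%:E -> oca_step c lambda q mu tk (t_ k.+1),
        forall k : nat, t_ k = +oo%E -> t_ k.+1 = +oo%E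
      & forall t : R, 0 <= t -> exists k, (t_ k <= t%:E < t_ k.+1)%E].

(* Main.v *)
Require Import Defs.
From mathcomp Require Import all_boot all_order all_algebra perm.
From mathcomp Require Import reals constructive_ereal zify ring lra.
Import Order.TTheory GRing.Theory Num.Theory.
Local Open Scope ring_scope.

Set Implicit Arguments.
Unset Strict Implicit.
Unset Printing Implicit Defensive.

(** The proof rests on the holding cost [c . q], which decreases along the
    process as long as the system is not empty.

    Fix one pass of the algorithm, with state [q], threshold [tau] and policy
    [nu] of total mass one, optimal for the linear program at [tau].  During the
    pass the cost has the constant slope
    [c . lambda - c . (mu A) = c . lambda - V(tau) - tau], where [V(tau)] is the
    optimal value and [mu] is [nu] extended by zero.  Two facts make the slope
    negative while some queue is not empty.

    - A lower bound on [V(tau)].  Inside the capacity region, [lambda] is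
      [mu0 A] for some [mu0 >= 0] on schedules of total mass below one
      ([capacity_decomposition]): pad [lambda] to a square matrix with equal
      line sums and apply Birkhoff's theorem, proved here from Hall's.  The
      restriction of [mu0] to the schedules of weight at least [tau] is
      feasible, and discarding the others can only raise the objective, so
      [V(tau) >= c . lambda - tau * |mu0|].  The slope is then at most
      [- tau * (1 - |mu0|)] ([drift_le]).

    - A lower bound on [tau].  A schedule that serves no empty queue meets no
      constraint of the linear program, so if its weight exceeded [tau] the
      program would be unbounded ([optimal_threshold_ge]).  The zero schedule
      gives [tau >= 0]; if queue [r] is not empty, serving [r] alone gives
      [tau >= c r].

    So the cost never increases, and its slope is at most a fixed negative
    number as long as the state is not zero.  Queue lengths stay nonnegative
    ([step_ge0]), whence zero cost means an empty system: an empty system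
    remains empty, and the system is empty once a time proportional to the
    initial cost has passed. *)

(** * Perfect matchings in bipartite graphs *)

Definition neighbours (T : finType) (E : {set T * T}) (X : {set T}) : {set T} :=
  [set y | [exists x in X, (x, y) \in E]].

Lemma neighboursP (T : finType) (E : {set T * T}) (X : {set T}) y :
  reflect (exists2 x, x \in X & (x, y) \in E) (y \in neighbours E X).
Proof. by rewrite inE; apply: exists_inP. Qed.

(** Rado's step towards Hall's theorem.  If deleting [(x, y1)] and deleting
    [(x, y2)] both break Hall's condition, at [X1] and [X2] respectively, then
    [x] lies in both sets.  The two reduced neighbourhoods have union
    [N (X1 :|: X2)], since each deletion keeps the edge that the other one
    removes, and their intersection contains [N ((X1 :&: X2) :\ x)].  Counting
    then contradicts Hall's condition at these two sets. *)
Lemma hall_drop_edge (T : finType) (E : {set T * T}) (x y1 y2 : T) :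
  (forall X : {set T}, #|X| <= #|neighbours E X|)%N ->
  (x, y1) \in E -> (x, y2) \in E -> y1 != y2 ->
  exists2 y, (x, y) \in E &
    forall X : {set T}, (#|X| <= #|neighbours (E :\ (x, y)) X|)%N.
Proof.
move=> hall e1 e2 y12.
have [/forallP ok1|] := boolP [forall X : {set T},
    (#|X| <= #|neighbours (E :\ (x, y1)) X|)%N].
  by exists y1.
rewrite negb_forall => /existsP[X1]; rewrite -ltnNge => bad1.
have [/forallP ok2|] := boolP [forall X : {set T},
    (#|X| <= #|neighbours (E :\ (x, y2)) X|)%N].
  by exists y2.
rewrite negb_forall => /existsP[X2]; rewrite -ltnNge => bad2.
have inX y X : (#|neighbours (E :\ (x, y)) X| < #|X|)%N -> x \in X.
  move=> bad; apply: contraLR bad => xX; rewrite -leqNgt.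
  apply: leq_trans (hall X) (subset_leq_card _).
  apply/subsetP => z /neighboursP[u uX uz]; apply/neighboursP; exists u => //.
  rewrite !inE uz andbT; apply: contraNneq xX => -[<- _]//.
have x1 := inX _ _ bad1; have x2 := inX _ _ bad2.
have hU : (#|X1 :|: X2| <= #|neighbours (E :\ (x, y1)) X1
                         :|: neighbours (E :\ (x, y2)) X2|)%N.
  apply: leq_trans (hall _) (subset_leq_card _).
  apply/subsetP => z /neighboursP[u uX uz]; rewrite inE; apply/orP.
  have [ux|ux] := eqVneq u x.
    subst u; have [zy|zy] := eqVneq z y1.
      right; apply/neighboursP; exists x => //.
      by rewrite !inE uz andbT zy xpair_eqE eqxx.
    left; apply/neighboursP; exists x => //.
    by rewrite !inE uz andbT xpair_eqE eqxx.
  move: uX; rewrite inE => /orP[uX|uX]; [left|right];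
    by apply/neighboursP; exists u => //; rewrite !inE uz andbT xpair_eqE negb_and ux.
have hI : (#|(X1 :&: X2) :\ x| <= #|neighbours (E :\ (x, y1)) X1
                         :&: neighbours (E :\ (x, y2)) X2|)%N.
  apply: leq_trans (hall _) (subset_leq_card _).
  apply/subsetP => z /neighboursP[u]; rewrite !in_setD1 inE.
  move=> /andP[ux /andP[u1 u2]] uz; rewrite inE; apply/andP; split;
    by apply/neighboursP; exists u => //; rewrite !inE uz andbT xpair_eqE negb_and ux.
have xI : x \in X1 :&: X2 by rewrite inE x1.
have cI : #|X1 :&: X2| = #|(X1 :&: X2) :\ x|.+1.
  by rewrite (cardsD1 x) xI add1n.
have cN := cardsUI (neighbours (E :\ (x, y1)) X1) (neighbours (E :\ (x, y2)) X2).
have cX := cardsUI X1 X2.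
lia.
Qed.

(** Delete edges while some vertex has two neighbours.  Once every vertex has
    exactly one, Hall's condition on pairs says that the neighbour map is
    injective. *)
Lemma hall_perfect_matching (T : finType) (E : {set T * T}) :
  (forall X : {set T}, #|X| <= #|neighbours E X|)%N ->
  exists s : {perm T}, forall x, (x, s x) \in E.
Proof.
have [k] := ubnP #|E|; elim: k => // k IH in E *; rewrite ltnS => leEk hall.
have [/existsP[[x [y1 y2]] /and3P[e1 e2 y12]]|] :=
    boolP [exists u : T * (T * T),
      [&& (u.1, u.2.1) \in E, (u.1, u.2.2) \in E & u.2.1 != u.2.2]].
  have [y e hall'] := hall_drop_edge hall e1 e2 y12.
  have [|s hs] := IH _ _ hall'; first by rewrite (cardsD1 (x, y)) e in leEk.
  by exists s => z; have := hs z; rewrite inE => /andP[].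
rewrite negb_exists => /forallP single.
have uniqE x y y' : (x, y) \in E -> (x, y') \in E -> y = y'.
  by move=> e e'; apply/eqP; have := single (x, (y, y')); rewrite /= e e' /= negbK.
have exE x : exists y, (x, y) \in E.
  have := hall [set x]; rewrite cards1 card_gt0 => /set0Pn[y].
  by move=> /neighboursP[_ /set1P-> xy]; exists y.
pose f x := @xchoose _ (fun y => (x, y) \in E) (exE x).
have fE x : (x, f x) \in E by exact: (@xchooseP _ (fun y => (x, y) \in E) (exE x)).
have f_inj : injective f.
  move=> x y fxy; apply/eqP; apply/negPn/negP => xy.
  have := hall [set x; y]; rewrite cards2 xy leqNgt => /negP; apply.
  rewrite ltnS; apply: (@leq_trans #|[set f x]|); last by rewrite cards1.
  apply: subset_leq_card; apply/subsetP => z.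
  move=> /neighboursP[u]; rewrite !inE => /orP[]/eqP-> uz; last rewrite fxy;
    by rewrite (uniqE _ _ _ uz (fE _)).
by exists (perm f_inj) => x; rewrite permE.
Qed.

(** * Birkhoff's theorem and the capacity region *)

(** Double counting: the rows in [X] carry total mass [sigma * #|X|], all of it
    in the columns of the neighbourhood of [X], whose total mass is [sigma]
    times their number. *)
Lemma doubly_stochastic_hall (R : realType) (T : finType) (M : T -> T -> R)
    (sigma : R) :
  (forall x y, 0 <= M x y) -> 0 < sigma ->
  (forall x, \sum_y M x y = sigma) -> (forall y, \sum_x M x y = sigma) ->
  forall X : {set T}, (#|X| <= #|neighbours [set u | (M u.1 u.2 != 0)%R] X|)%N.
Proof.
move=> M0 s0 row col X; set N := neighbours _ _.
have rows : \sum_(x in X) \sum_y M x y = sigma * #|X|%:R.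
  by rewrite (eq_bigr (fun=> sigma))// sumr_const mulr_natr.
have cols : \sum_(y in N) \sum_x M x y = sigma * #|N|%:R.
  by rewrite (eq_bigr (fun=> sigma))// sumr_const mulr_natr.
rewrite -(ler_nat R) -(ler_pM2l s0) -rows -cols.
rewrite [leRHS]exchange_big/= big_mkcond /=; apply: ler_sum => x _.
case: ifP => xX; last by apply: sumr_ge0.
rewrite [leRHS]big_mkcond/=; apply: ler_sum => y _.
case: ifP => // /negbT yN; rewrite le_eqVlt; apply/orP; left.
apply: contraNT yN => xy; apply/neighboursP; exists x => //.
by rewrite inE.
Qed.

(** Subtract from [M] the largest multiple of a permutation matrix in its
    support that keeps the entries nonnegative: the line sums stay equal and
    the support shrinks.  The total mass is only bounded, because over an empty
    [T] the line sums say nothing about [sigma]. *)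
Lemma birkhoff (R : realType) (T : finType) (M : T -> T -> R) (sigma : R) :
  (forall x y, 0 <= M x y) -> 0 <= sigma ->
  (forall x, \sum_y M x y = sigma) -> (forall y, \sum_x M x y = sigma) ->
  exists mu : {perm T} -> R,
    [/\ forall s, 0 <= mu s, \sum_s mu s <= sigma
      & forall x y, \sum_s mu s * (s x == y)%:R = M x y].
Proof.
have [k] := ubnP #|[set u : T * T | M u.1 u.2 != 0]|.
elim: k => // k IH in M sigma *; rewrite ltnS => leMk M0 s0 row col.
have [/forallP allM0|] := boolP [forall u : T * T, M u.1 u.2 == 0].
  exists (fun=> 0); split=> //; first by rewrite big1.
  move=> x y; rewrite big1 => [|s _]; last by rewrite mul0r.
  by have /eqP := allM0 (x, y).
rewrite negb_forall => /existsP[[x0 y0] /= xy0].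
have spos : 0 < sigma.
  rewrite -(row x0) (bigD1 y0)//= ltr_pwDl ?sumr_ge0 ?lt_def ?xy0 ?M0//.
have [s sM] := hall_perfect_matching
  (doubly_stochastic_hall M0 spos row col).
have {}sM x : M x (s x) != 0 by have := sM x; rewrite inE.
(* [a] is the largest multiple of the permutation matrix that fits in [M]. *)
pose xm := [arg min_(x < x0) M x (s x)]%O; pose a := M xm (s xm).
have aM x : a <= M x (s x).
  by rewrite /a /xm; case: arg_minP => // i _; apply.
have apos : 0 < a by rewrite lt_def sM M0.
pose M' x y := M x y - a * (s x == y)%:R.
have row' x : \sum_y M' x y = sigma - a.
  rewrite sumrB row -mulr_sumr (bigD1 (s x))//= eqxx big1 ?addr0 ?mulr1//.
  by move=> y; rewrite eq_sym => /negbTE->.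
have col' y : \sum_x M' x y = sigma - a.
  rewrite sumrB col -mulr_sumr (bigD1 ((s^-1)%g y))//= permKV eqxx.
  rewrite big1 ?addr0 ?mulr1// => x xy; case: eqP => // sxy.
  by move: xy; rewrite -sxy permK eqxx.
have M'0 x y : 0 <= M' x y.
  rewrite /M'; case: eqP => [<-|_]; first by rewrite mulr1 subr_ge0.
  by rewrite mulr0 subr0.
have s'0 : 0 <= sigma - a by rewrite -(row' x0) sumr_ge0.
have [|mu [mu0 musum muM]] := IH M' _ _ M'0 s'0 row' col'.
  apply: leq_trans leMk; apply/proper_card/properP; split.
    apply/subsetP => -[x y]; rewrite !inE /M' /=; apply: contraNneq => Mxy.
    have := M'0 x y; rewrite /M' Mxy; case: eqP => _;
      rewrite ?mulr1 ?mulr0 ?subrr// sub0r.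
    by rewrite oppr_ge0 leNgt apos.
  exists (xm, s xm); rewrite !inE /= ?sM//.
  by rewrite /M' eqxx mulr1 subrr eqxx.
have delta (F : {perm T} -> R) : \sum_s' a * (s == s')%:R * F s' = a * F s.
  rewrite (bigD1 s)//= eqxx mulr1 big1 ?addr0// => s' ss'.
  by rewrite eq_sym (negbTE ss') mulr0 mul0r.
exists (fun s' => mu s' + a * (s == s')%:R); split=> [s'||x y].
- by rewrite addr_ge0 // mulr_ge0// ltW.
- have -> : \sum_s' (mu s' + a * (s == s')%:R) = \sum_s' mu s' + a.
    rewrite big_split /= -[a in RHS]mulr1 -(delta (fun=> 1)); congr (_ + _).
    by apply: eq_bigr => s' _; rewrite mulr1.
  by rewrite -lerBrDr.
under eq_bigr => s' _ do rewrite mulrDl.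
by rewrite big_split /= muM delta subrK.
Qed.

Lemma positive_lower_bound (R : realType) (I : finType) (f : I -> R) :
  (forall i, 0 < f i) -> exists2 d : R, 0 < d <= 1 & forall i, d <= f i.
Proof.
move=> f0; exists (\big[Num.min/1]_i f i) => [|i].
  by rewrite bigmin_le_id andbT; apply: lt_bigmin.
exact: bigmin_le_cond.
Qed.

Lemma sum_bool_le1 (I : finType) (b : I -> bool) :
  (forall i i', b i -> b i' -> i = i') -> (\sum_i b i <= 1)%N.
Proof.
move=> b1; have [/existsP[i bi]|] := boolP [exists i, b i].
  rewrite (bigD1 i)//= bi big1// => i' ii'.
  by case: (boolP (b i')) => // /(b1 _ _ bi) E; rewrite E eqxx in ii'.
rewrite negb_exists => /forallP b0; rewrite big1// => i _.
by rewrite (negbTE (b0 i)).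
Qed.

Lemma is_schedule_matching (n : nat) (f : {ffun queue n -> bool}) :
  (forall i i' j, f (i, j) -> f (i', j) -> i = i') ->
  (forall i j j', f (i, j) -> f (i, j') -> j = j') -> is_schedule f.
Proof.
move=> col row; apply/andP; split; apply/forallP => k; apply: sum_bool_le1.
- by move=> i i'; apply: col.
- by move=> j j'; apply: row.
Qed.

(** The top left block of the permutation matrix of [s]. *)
Definition corner (n : nat) (s : {perm 'I_n + 'I_n}) : {ffun queue n -> bool} :=
  [ffun r => s (inl r.1) == inl r.2].

Lemma corner_is_schedule (n : nat) (s : {perm 'I_n + 'I_n}) :
  is_schedule (corner s).
Proof.
apply: is_schedule_matching => [i i' j|i j j']; rewrite !ffunE /=.
- by move=> /eqP <- /eqP/perm_inj[].
- by move=> /eqP-> /eqP[].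
Qed.

(** If [1 - d] bounds the line sums of [lambda], then the block matrix
    [[lambda, D1], [D2, lambda^T]], with the slacks of the rows and of the
    columns of [lambda] on the diagonals [D1] and [D2], has all line sums
    [1 - d].  Birkhoff's theorem splits it into permutations, whose top left
    corners are schedules. *)
Lemma capacity_decomposition (R : realType) (n : nat)
    (lambda : {ffun queue n -> R}) :
  in_capacity_region lambda ->
  exists mu : {ffun schedule n -> R},
    [/\ forall s, 0 <= mu s, \sum_s mu s < 1
      & forall r, muA mu r = lambda r].
Proof.
move=> [lam01 col row].
have lam0 r : 0 <= lambda r by have /andP[] := lam01 r.
pose slack (k : 'I_n + 'I_n) : R := match k with
  | inl i => 1 - \sum_j lambda (i, j) | inr j => 1 - \sum_i lambda (i, j) end.
have [|d /andP[d0 d1] dE] := @positive_lower_bound R _ slack.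
  by case=> k; rewrite subr_gt0.
pose M (x y : 'I_n + 'I_n) : R := match x, y with
  | inl i, inl j => lambda (i, j)
  | inl i, inr i' => (i == i')%:R * (slack (inl i) - d)
  | inr j, inl j' => (j == j')%:R * (slack (inr j) - d)
  | inr j, inr i => lambda (i, j) end.
have delta (i : 'I_n) (F : 'I_n -> R) : \sum_k (i == k)%:R * F k = F i.
  rewrite (bigD1 i)//= eqxx mul1r big1 ?addr0// => k ik.
  by rewrite eq_sym (negbTE ik) mul0r.
have delta' (i : 'I_n) (F : 'I_n -> R) : \sum_k (k == i)%:R * F k = F i.
  by rewrite -[RHS]delta; apply: eq_bigr => k _; rewrite eq_sym.
have [|||| mu [mu0 muD muM]] := @birkhoff R _ M (1 - d).
- by move=> [i|j] [j'|i']; rewrite /M ?lam0 ?mulr_ge0 ?subr_ge0 ?dE.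
- by rewrite subr_ge0.
- move=> [i|j]; rewrite big_sumType /M /=.
  + by rewrite (delta _ (fun=> _)); lra.
  + by rewrite (delta _ (fun=> _)); lra.
- move=> [j|i]; rewrite big_sumType /M /=.
  + by rewrite (delta' _ (fun k => slack (inr k) - d)) /slack; lra.
  + by rewrite (delta' _ (fun k => slack (inl k) - d)) /slack; lra.
pose S s : schedule n := exist _ (corner s) (corner_is_schedule s).
pose mu' : {ffun schedule n -> R} := [ffun s' => \sum_(s | S s == s') mu s].
have muS (F : schedule n -> R) : \sum_s' mu' s' * F s' = \sum_s mu s * F (S s).
  rewrite (partition_big S xpredT)//=; apply: eq_bigr => s' _.
  by rewrite ffunE mulr_suml; apply: eq_bigr => s /eqP->.
exists mu'; split=> [s'||[i j]].
- by rewrite ffunE sumr_ge0.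
- have := muS (fun=> 1).
  rewrite (eq_bigr mu') => [->|s _]; last by rewrite mulr1.
  rewrite (eq_bigr mu) => [|s _]; last by rewrite mulr1.
  lra.
- rewrite /muA muS -[RHS](muM (inl i) (inl j)); apply: eq_bigr => s _.
  by rewrite /Amat /serves /= ffunE.
Qed.

(** * Bounds from the linear program *)

Lemma sum_Itau (R : realType) (n : nat) (c : {ffun queue n -> R}) (tau : R)
    (F : schedule n -> R) :
  \sum_(s | tau <= weight c s) F s = \sum_(s : Itau c tau) F (sval s).
Proof.
rewrite (@reindex_omap _ _ _ _ _ (fun t : Itau c tau => sval t) insub).
  by apply: eq_bigl => t; rewrite (valP t) (valK t) eqxx.
by move=> s hs; rewrite insubT.
Qed.

Lemma sum_extend0 (R : realType) (n : nat) (c : {ffun queue n -> R}) (tau : R)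
    (nu : {ffun Itau c tau -> R}) (F : schedule n -> R) :
  \sum_s extend0 nu s * F s = \sum_s nu s * F (sval s).
Proof.
rewrite (bigID (fun s => tau <= weight c s))/= [X in _ + X]big1 ?addr0.
  by rewrite sum_Itau; apply: eq_bigr => t _; rewrite ffunE (valK t).
by move=> s hs; rewrite ffunE insubN ?mul0r.
Qed.

Lemma sum_weight (R : realType) (n : nat) (c : {ffun queue n -> R})
    (mu : {ffun schedule n -> R}) :
  \sum_s mu s * weight c s = \sum_r c r * muA mu r.
Proof.
under [RHS]eq_bigr => r _ do rewrite mulr_sumr.
rewrite exchange_big/=; apply: eq_bigr => s _.
rewrite /weight big_mkcond mulr_sumr; apply: eq_bigr => r _.
by rewrite /Amat; case: serves; rewrite ?mulr1 ?mulr0 // mulrC.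
Qed.

(** No constraint of the linear program limits a schedule that serves only
    nonempty queues, so its objective coefficient [weight c s - tau] cannot be
    positive: adding one unit of [s] would improve the optimum. *)
Lemma optimal_threshold_ge (R : realType) (n : nat)
    (c lambda q : {ffun queue n -> R}) (tau : R) (nu : {ffun Itau c tau -> R})
    (s : schedule n) :
  P_optimal c lambda q tau nu -> (forall r, serves s r -> q r != 0) ->
  weight c s <= tau.
Proof.
move=> [[nuA nu0] nu_max] free; rewrite leNgt; apply/negP => tau_s.
pose s0 : Itau c tau := exist _ s (ltW tau_s).
pose e (t : Itau c tau) : R := (t == s0)%:R.
have sum_e (F : Itau c tau -> R) : \sum_t e t * F t = F s0.
  rewrite (bigD1 s0)//= /e eqxx mul1r big1 ?addr0// => t /negbTE->.
  by rewrite mul0r.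
have := nu_max [ffun t => nu t + e t]; rewrite leNgt => /(_ _)/negP; apply.
  split=> [r|t]; last by rewrite ffunE addr_ge0// ler0n.
  under eq_bigr => t _ do rewrite ffunE mulrDl.
  rewrite big_split /= sum_e [X in _ + X](_ : _ = 0) ?addr0//.
  apply/eqP; rewrite /Atq /Amat pnatr_eq0 eqb0; apply/negP => /free.
  by rewrite (valP r).
rewrite /dot; under [ltRHS]eq_bigr => t _ do
  rewrite [X in _ * X]ffunE mulrDr [_ * e _]mulrC.
by rewrite big_split /= sum_e ffunE ltrDl subr_gt0.
Qed.

(** The left-hand side is the slope of the cost under the policy [nu].  The
    competitor in the linear program is the restriction of [mu0] to the
    schedules of weight at least [tau]. *)
Lemma drift_le (R : realType) (n : nat) (c lambda q : {ffun queue n -> R})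
    (mu0 : {ffun schedule n -> R}) (tau gamma : R) (nu : {ffun Itau c tau -> R}) :
  (forall s, 0 <= mu0 s) -> (forall r, muA mu0 r = lambda r) ->
  P_value c lambda q tau gamma -> Qset c lambda q tau gamma nu ->
  \sum_r c r * (lambda r - muA (extend0 nu) r) <= - (tau * (1 - \sum_s mu0 s)).
Proof.
move=> mu00 mu0A [x [_ x_max] xg] [[_ nu0] nug nu1].
have sum_nu : \sum_s nu s = 1.
  by rewrite -nu1; apply: eq_bigr => s _; rewrite ger0_norm.
have nu_obj : dot (wtau c tau) nu = \sum_r c r * muA (extend0 nu) r - tau.
  rewrite -sum_weight sum_extend0 -[X in _ - X]mulr1 -sum_nu mulr_sumr -sumrB.
  by apply: eq_bigr => s _; rewrite ffunE mulrBl mulrC.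
pose x0 : {ffun Itau c tau -> R} := [ffun s => mu0 (sval s)].
have x0_feas : feasible (Atq c tau q) (lambdaq lambda q) x0.
  split=> [r|s]; last by rewrite ffunE.
  rewrite /lambdaq -mu0A /muA.
  rewrite [leRHS](bigID (fun s => tau <= weight c s))/= ler_wpDr//.
    by apply: sumr_ge0 => s _; rewrite mulr_ge0 ?ler0n.
  rewrite sum_Itau le_eqVlt; apply/orP; left; apply/eqP.
  by apply: eq_bigr => t _; rewrite ffunE.
have x0_obj : \sum_r c r * lambda r - tau * \sum_s mu0 s <= dot (wtau c tau) x0.
  have -> : \sum_r c r * lambda r = \sum_s mu0 s * weight c s.
    by rewrite sum_weight; apply: eq_bigr => r _; rewrite mu0A.
  rewrite mulr_sumr -sumrB (bigID (fun s => tau <= weight c s))/=.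
  rewrite sum_Itau ler_wnDr//.
    apply: sumr_le0 => s; rewrite -ltNge => /ltW ws.
    by rewrite [tau * _]mulrC -mulrBr mulr_ge0_le0 ?subr_le0.
  rewrite le_eqVlt; apply/orP; left; apply/eqP; apply: eq_bigr => t _.
  by rewrite !ffunE [tau * _]mulrC -mulrBr mulrC.
have := x_max _ x0_feas; rewrite xg -nug nu_obj => x0_le.
under eq_bigr => r _ do rewrite mulrBr.
rewrite sumrB mulrBr mulr1; lra.
Qed.

(** * One pass of the algorithm *)

Lemma holding_time_ge0 (R : realType) (n : nat) (lambda q : {ffun queue n -> R})
    (mu : {ffun schedule n -> R}) :
  (forall r, 0 <= q r) -> (0 <= holding_time lambda q mu)%E.
Proof.
move=> q0; apply: le_bigmin => [|r /andP[_ /ltW d0]]; first exact: leey.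
by rewrite lee_fin divr_ge0.
Qed.

(** An empty queue does not drain because its constraint is part of the linear
    program; a nonempty one has no time to become negative by the choice of the
    holding time. *)
Lemma step_ge0 (R : realType) (n : nat) (c lambda : {ffun queue n -> R})
    (q : R -> {ffun queue n -> R}) (mu : R -> {ffun schedule n -> R})
    (tk : R) (tk' : \bar R) :
  oca_step c lambda q mu tk tk' -> (forall r, 0 <= q tk r) ->
  (tk%:E <= tk')%E /\
  forall t : R, (tk%:E <= t%:E <= tk')%E -> forall r, 0 <= q t r.
Proof.
move=> [tau [gamma [nu [_ [[nuA nu0] _ _] tkE _ qE]]]] q0.
split=> [|t tt r]; first by rewrite tkE leeDl// holding_time_ge0.
rewrite (qE t tt r); move: tt; rewrite tkE => /andP[]; rewrite lee_fin -subr_ge0 => t0.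
rewrite -[t]addr0 -(subrr tk) addrCA EFinD leeD2lE// => t1.
set b := muA _ r; have [db|db] := ltrP 0 (b - lambda r); last first.
  have := mulr_ge0_le0 t0 db; have := q0 r; lra.
have [qr0|qr0] := eqVneq (q tk r) 0.
  have /= := nuA (exist _ r (introT eqP qr0)); rewrite /lambdaq /Atq /= => nuAr.
  suff : b <= lambda r by move: db; lra.
  by rewrite /b /muA sum_extend0.
have : ((t - tk)%:E <= (q tk r / (b - lambda r))%:E)%E.
  apply: le_trans t1 _; apply: bigmin_le_cond.
  by rewrite qr0.
rewrite lee_fin ler_pdivlMr//; lra.
Qed.

Lemma threshold_ge (R : realType) (n : nat)
    (c lambda q : {ffun queue n -> R}) (tau : R) (nu : {ffun Itau c tau -> R}) r :
  P_optimal c lambda q tau nu -> q r != 0 -> c r <= tau.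
Proof.
move=> nu_opt qr.
have ok : is_schedule [ffun r' : queue n => r' == r].
  apply: is_schedule_matching => [i i' j|i j j']; rewrite !ffunE.
    by move=> /eqP<- /eqP[].
  by move=> /eqP<- /eqP[].
pose s1 : schedule n := exist (fun f => is_schedule f) _ ok.
apply: (@le_trans _ _ (weight c s1)); last apply: (optimal_threshold_ge nu_opt).
  by rewrite /weight (big_pred1 r)// => r'; rewrite /serves /= ffunE.
by move=> r'; rewrite /serves /= ffunE => /eqP->.
Qed.

Lemma threshold_ge0 (R : realType) (n : nat)
    (c lambda q : {ffun queue n -> R}) (tau : R) (nu : {ffun Itau c tau -> R}) :
  P_optimal c lambda q tau nu -> 0 <= tau.
Proof.
move=> nu_opt.
have ok : is_schedule [ffun _ : queue n => false].
  by apply: is_schedule_matching => [i i' j|i j j']; rewrite !ffunE.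
pose s1 : schedule n := exist (fun f => is_schedule f) _ ok.
apply: (@le_trans _ _ (weight c s1)); last apply: (optimal_threshold_ge nu_opt).
  by rewrite /weight big_pred0// => r'; rewrite /serves /= ffunE.
by move=> r'; rewrite /serves /= ffunE.
Qed.

(** The boolean factor merges the two bounds on the threshold, which is
    nonnegative in any case and at least [cmin] when the state is not zero. *)
Lemma step_drift (R : realType) (n : nat) (c lambda : {ffun queue n -> R})
    (mu0 : {ffun schedule n -> R}) (cmin : R)
    (q : R -> {ffun queue n -> R}) (mu : R -> {ffun schedule n -> R})
    (tk : R) (tk' : \bar R) (s t : R) :
  (forall s, 0 <= mu0 s) -> (forall r, muA mu0 r = lambda r) ->
  \sum_s mu0 s < 1 -> (forall r, cmin <= c r) ->
  oca_step c lambda q mu tk tk' -> (tk%:E <= s%:E)%E -> s <= t -> (t%:E <= tk')%E ->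
  dot c (q t) <= dot c (q s)
    - (q tk != 0)%:R * (cmin * (1 - \sum_s mu0 s)) * (t - s).
Proof.
move=> mu00 mu0A mu01 cE [tau [gamma [nu [[_ Pg] Q _ _ qE]]]] ks st tk's.
have drift := drift_le mu00 mu0A Pg Q.
set S := \sum_s mu0 s in mu01 drift *.
have tau_ge : (q tk != 0)%:R * cmin <= tau.
  have [x x_opt _] := Pg; have [_|qn0] := eqVneq.
    by rewrite mul0r (threshold_ge0 x_opt).
  rewrite mul1r; have [r qr] : exists r, q tk r != 0.
    apply/existsP; apply: contraNT qn0; rewrite negb_exists => /forallP q0.
    by apply/eqP/ffunP => r; have := q0 r; rewrite negbK ffunE => /eqP.
  exact: le_trans (cE r) (threshold_ge x_opt qr).
have diff : dot c (q t) - dot c (q s) =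
    (t - s) * \sum_r c r * (lambda r - muA (extend0 nu) r).
  rewrite mulr_sumr -sumrB; apply: eq_bigr => r _.
  rewrite (qE t) ?(qE s).
  - by move: (q tk r) (muA _ r) (lambda r) (c r) => a b l x; ring.
  - by rewrite ks (le_trans _ tk's)// lee_fin.
  - by rewrite (le_trans ks) ?lee_fin.
have : (t - s) * \sum_r c r * (lambda r - muA (extend0 nu) r) <=
    (t - s) * - ((q tk != 0)%:R * cmin * (1 - S)).
  rewrite ler_wpM2l ?subr_ge0//; apply: le_trans drift _.
  by rewrite lerN2 ler_wpM2r// subr_ge0 ltW.
lra.
Qed.

(** * The whole process *)

(** The rate is required only up to the final time [t], so that the lemma
    applies when it is known only while the system has not emptied. *)
Lemma decrease_along_steps (R : realType) (t_ : nat -> \bar R) (V : R -> R)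
    (delta s t : R) :
  t_ 0%N = 0%E -> (forall k, (t_ k <= t_ k.+1)%E) ->
  (forall u : R, 0 <= u -> exists k, (t_ k <= u%:E < t_ k.+1)%E) ->
  (forall k u v, (t_ k <= u%:E)%E -> u <= v -> (v%:E <= t_ k.+1)%E -> v <= t ->
    V v <= V u - delta * (v - u)) ->
  0 <= s -> s <= t -> V t <= V s - delta * (t - s).
Proof.
move=> t0 t_le cover step s0 st.
have [k /andP[kt /ltW tk]] := cover _ (le_trans s0 st).
elim: k t => [|k IH] t in step st kt tk *.
  by apply: step st tk _; rewrite ?t0 ?lee_fin.
have [ks|] := leP (t_ k.+1) s%:E; first exact: step ks st tk _.
case tkE : (t_ k.+1) kt => [u| |]//; rewrite lee_fin lte_fin => ut su.
have : V u <= V s - delta * (u - s).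
  apply: IH; rewrite ?tkE ?lexx -?tkE ?t_le ?ltW// => j v w jv vw wj wu.
  by apply: step jv vw wj _; apply: le_trans ut.
have : V t <= V u - delta * (t - u) by apply: (step k.+1); rewrite ?tkE.
lra.
Qed.

Theorem theorem3p6 (R : realType) (n : nat)
    (c lambda q0 : {ffun queue n -> R})
    (q : R -> {ffun queue n -> R}) (mu : R -> {ffun schedule n -> R})
    (hn : (1 <= n)%N)
    (hc : forall r, 0 < c r)
    (hlambda : in_capacity_region lambda)
    (hq0 : forall r, 0 <= q0 r)
    (hrun : oca_process c lambda q0 q mu) :
  (exists2 T : R, 0 <= T & q T = 0) /\
  (forall T : R, 0 <= T -> q T = 0 -> forall t : R, T <= t -> q t = 0).
Proof.
have [t_ [[t0 qq0] step stop cover]] := hrun.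
have [mu0 [mu00 mu01 mu0A]] := capacity_decomposition hlambda.
have [cmin /andP[cmin0 _] cminE] := positive_lower_bound hc.
pose delta := cmin * (1 - \sum_s mu0 s).
have delta0 : 0 < delta by rewrite mulr_gt0// subr_gt0.
have step_inv k : (0 <= t_ k)%E -> (forall u, t_ k = u%:E -> forall r, 0 <= q u r) ->
    (t_ k <= t_ k.+1)%E /\
    forall t : R, (t_ k <= t%:E <= t_ k.+1)%E -> forall r, 0 <= q t r.
  case tkE : (t_ k) => [u| |]// _ qu.
    exact: step_ge0 (step _ _ tkE) (qu u erefl).
  by rewrite (stop _ tkE) lexx; split=> // t; rewrite leye_eq.
have inv k : (0 <= t_ k)%E /\ (forall u, t_ k = u%:E -> forall r, 0 <= q u r).
  elim: k => [|k [tk0 qk]]; first by rewrite t0; split=> // u [<-]; rewrite qq0.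
  have [t_le qt] := step_inv k tk0 qk; split=> [|u uE]; first exact: le_trans t_le.
  by apply: qt; rewrite -uE t_le lexx.
have t_le k : (t_ k <= t_ k.+1)%E by case: (inv k) => ? /step_inv[].
have q_ge0 t r : 0 <= t -> 0 <= q t r.
  move=> /cover[k /andP[kt /ltW tk]]; have [tk0 qk] := inv k.
  by apply: (step_inv k tk0 qk).2; rewrite kt.
have cost0 t : 0 <= t -> dot c (q t) <= 0 -> q t = 0.
  move=> tge0 cq; apply/ffunP => r; rewrite ffunE; apply/eqP.
  have ge0 r' : 0 <= c r' * q t r' by apply: mulr_ge0; [exact: ltW|exact: q_ge0].
  have /eqP : dot c (q t) = 0 by apply/le_anti; rewrite cq sumr_ge0.
  rewrite psumr_eq0// => /allP/(_ r); rewrite mem_index_enum => /(_ isT)/=.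
  by rewrite mulf_eq0 gt_eqF.
have drift d s t : 0 <= s -> s <= t ->
    (forall k u, t_ k = u%:E -> u <= t -> d <= (q u != 0)%:R * delta) ->
    dot c (q t) <= dot c (q s) - d * (t - s).
  move=> s0 st dE.
  apply: (decrease_along_steps (V := fun u => dot c (q u)) t0 t_le cover) => //.
  move=> k u v ku uv vk vt.
  case tkE : (t_ k) ku => [w| |]// ku; last by have [] := inv k; rewrite tkE.
  apply: le_trans (step_drift mu00 mu0A mu01 cminE (step _ _ tkE) ku uv vk) _.
  rewrite lerD2l lerN2 ler_wpM2r ?subr_ge0//; apply: dE tkE _.
  by apply: le_trans vt; apply: le_trans uv; rewrite -lee_fin.
have stays T t : 0 <= T -> T <= t -> q T = 0 -> q t = 0.
  move=> T0 Tt qT; apply: cost0; first exact: le_trans Tt.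
  have := drift 0 T t T0 Tt; rewrite mul0r subr0 => /(_ _)/le_trans; apply.
    by move=> k u _ _; rewrite mulr_ge0 ?ler0n ?ltW.
  by rewrite qT /dot big1// => r _; rewrite ffunE mulr0.
split=> [|T T0 qT t Tt]; last exact: stays qT.
pose T := dot c q0 / delta.
have T0 : 0 <= T.
  apply: divr_ge0 (ltW delta0); apply: sumr_ge0 => r _.
  by apply: mulr_ge0 => //; exact: ltW.
(* Were the system not empty at [T], it would not have been empty at any
   earlier time, and its cost would have dropped at rate [delta] all along. *)
exists T => //; have [//|qT] := eqVneq (q T) 0.
apply: cost0 => //; have -> : 0 = dot c (q 0) - delta * (T - 0).
  by rewrite subr0 mulrC divfK ?gt_eqF// qq0 subrr.
apply: drift => // k u tk uT; have [qu|_] := eqVneq; last by rewrite mul1r.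
have [] := inv k; rewrite tk lee_fin => u0 _.
by rewrite (stays _ _ u0 uT qu) eqxx in qT.
Qed.
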